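(* Let $\mathfrak{B}$ be a Bol algebra of dimension 3 with trilinear operation of Type II whose canonical enveloping Lie algebra has dimension 4. Then $\mathfrak{B}$ is isotopic to one of the following Bol algebras with basis $e_1,e_2,e_3$, in each of which $(e_2,e_3,e_3)=e_1$ (all operations on basis vectors not listed, and not following by skew-symmetry in the first two arguments, are zero): 2. $e_2\cdot e_3=-e_3$; 3. $e_2\cdot e_3=-e_2$; 4. $e_2\cdot e_3=-e_1$.
   Context: A Bol algebra is a finite-dimensional real vector space $\mathfrak{B}$ with a bilinear operation $x\cdot y$ and a trilinear operation $(x,y,z)$ such that for all elements: $x\cdot x=0$; $(x,x,y)=0$; $(x,y,z)+(y,z,x)+(z,x,y)=0$; $(x,y,(z,\xi,\eta))=((x,y,z),\xi,\eta)+(z,(x,y,\xi),\eta)+(z,\xi,(x,y,\eta))$; $(x,y,z)\cdot\xi-(x,y,\xi)\cdot z+(z,\xi,x\cdot y)-(x,y,z\cdot\xi)+(x\cdot y)\cdot(z\cdot\xi)=0$. Type II: the trilinear operation is of Type II if in some basis $e_1,e_2,e_3$ of $\mathfrak{B}$ it is given by $(e_2,e_3,e_3)=e_1=-(e_3,e_2,e_3)$, all other $(e_i,e_j,e_k)$ being zero. Canonical enveloping Lie algebra: an enveloping pair of a Bol algebra $\mathfrak{B}$ consists of a finite-dimensional real Lie algebra $\mathfrak{G}$ containing $\mathfrak{B}$ as a vector subspace and a subalgebra $\mathfrak{h}$ with $\mathfrak{G}=\mathfrak{B}\oplus\mathfrak{h}$ (direct sum of vector spaces), $[[\mathfrak{B},\mathfrak{B}],\mathfrak{B}]\subset\mathfrak{B}$,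 $x\cdot y$ equal to the projection of $[x,y]$ onto $\mathfrak{B}$ parallel to $\mathfrak{h}$, and $(x,y,z)=[[x,y],z]$. It is canonical if $\mathfrak{B}$ generates $\mathfrak{G}$ as a Lie algebra and $\mathfrak{h}$ contains no nonzero ideal of $\mathfrak{G}$. Isotopic Bol algebras: let $\mathfrak{G}=\mathfrak{B}\oplus\mathfrak{h}$ and $\widetilde{\mathfrak{G}}=\widetilde{\mathfrak{B}}\oplus\widetilde{\mathfrak{h}}$ be the canonical enveloping Lie algebras of $\mathfrak{B}$ and $\widetilde{\mathfrak{B}}$. The Bol algebras are isotopic if there exist a Lie algebra isomorphism $\Phi:\mathfrak{G}\to\widetilde{\mathfrak{G}}$ with $\Phi(\mathfrak{B})=\widetilde{\mathfrak{B}}$ and an element $\xi\in\widetilde{\mathfrak{B}}$ such that $\Phi(\mathfrak{h})=(\mathrm{Ad}\,\xi)\,\widetilde{\mathfrak{h}}$, where $\mathrm{Ad}\,\xi=\exp(\mathrm{ad}\,\xi)$. *)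

(* Defs.v *)
From HB Require Import structures.
From mathcomp Require Import all_boot all_order all_algebra.
From mathcomp Require Import all_classical all_reals all_analysis.
Set Implicit Arguments.
Unset Strict Implicit.
Unset Printing Implicit Defensive.
Import Order.TTheory GRing.Theory Num.Theory.
Import numFieldNormedType.Exports.
Import VectorInternalTheory.
Local Open Scope classical_set_scope.
Local Open Scope ring_scope.

Record bolAlgebra (R : realType) := BolAlgebra {
  bol_sort :> vectType R;
  bmul : bol_sort -> bol_sort -> bol_sort;
  btri : bol_sort -> bol_sort -> bol_sort -> bol_sort;
  bmul_linearl : forall y, linear (fun x => bmul x y);
  bmul_linearr : forall x, linear (fun y => bmul x y);
  btri_linear1 : forall y z, linear (fun x => btri x y z);
  btri_linear2 : forall x z, linear (fun y => btri x y z);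
  btri_linear3 : forall x y, linear (fun z => btri x y z);
  bmulxx : forall x, bmul x x = 0;
  btrixx : forall x y, btri x x y = 0;
  btri_cyclic : forall x y z, btri x y z + btri y z x + btri z x y = 0;
  btri_derivation : forall x y z u v,
    btri x y (btri z u v) =
      btri (btri x y z) u v + btri z (btri x y u) v + btri z u (btri x y v);
  bol_identity : forall x y z u,
    bmul (btri x y z) u - bmul (btri x y u) z + btri z u (bmul x y)
      - btri x y (bmul z u) + bmul (bmul x y) (bmul z u) = 0
}.

Record lieAlgebra (R : realType) := LieAlgebra {
  lie_sort :> vectType R;
  lbr : lie_sort -> lie_sort -> lie_sort;
  lbr_linearl : forall y, linear (fun x => lbr x y);
  lbr_linearr : forall x, linear (fun y => lbr x y);
  lbrxx : forall x, lbr x x = 0;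
  lbr_jacobi : forall x y z,
    lbr x (lbr y z) + lbr y (lbr z x) + lbr z (lbr x y) = 0
}.

Section LieNotions.
Variables (R : realType) (G : lieAlgebra R).

Definition lie_subalgebra (U : {vspace G}) : Prop :=
  forall x y : G, x \in U -> y \in U -> lbr x y \in U.

Definition lie_ideal (U : {vspace G}) : Prop :=
  forall x y : G, y \in U -> lbr x y \in U.

Definition lie_generates (U : {vspace G}) : Prop :=
  forall W : {vspace G}, lie_subalgebra W -> (U <= W)%VS -> W = fullv.

(* exp(ad x) y = \sum_k (ad x)^k y / k!, the limit being taken in the
   coordinate space 'rV[R]_(\dim G); the series always converges, so that
   [lim] never returns a default value *)
Definition lie_Ad (x y : G) : G :=
  r2v (lim (series (fun k : nat =>
    (k`!%:R : R)^-1 *: v2r (iter k (lbr x) y)) @ \oo)).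

End LieNotions.

Definition lie_isomorphism (R : realType) (G G' : lieAlgebra R)
    (Phi : 'Hom(G, G')) : Prop :=
  [/\ lker Phi = 0%VS, limg Phi = fullv
    & forall x y : G, Phi (lbr x y) = lbr (Phi x) (Phi y)].

(* An enveloping pair (G, h) of B; the inclusion of B in G is the injective
   linear map [env_inj], and B as a subspace of G is [env_base]. *)
Record enveloping (R : realType) (B : bolAlgebra R) := Enveloping {
  env_lie : lieAlgebra R;
  env_inj : 'Hom(B, env_lie);
  env_sub : {vspace env_lie};
  env_base := limg env_inj;
  env_inj_ker : lker env_inj = 0%VS;
  env_sub_lie : lie_subalgebra env_sub;
  env_full : (env_base + env_sub)%VS = fullv;
  env_direct : (env_base :&: env_sub)%VS = 0%VS;
  env_triple : forall x y z, x \in env_base -> y \in env_base ->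
    z \in env_base -> lbr (lbr x y) z \in env_base;
  env_mul : forall x y : B,
    env_inj (bmul x y) =
      daddv_pi env_base env_sub (lbr (env_inj x) (env_inj y));
  env_tri : forall x y z : B,
    env_inj (btri x y z) = lbr (lbr (env_inj x) (env_inj y)) (env_inj z)
}.

Definition env_canonical (R : realType) (B : bolAlgebra R)
    (E : enveloping B) : Prop :=
  lie_generates (env_base E) /\
  (forall I : {vspace env_lie E},
     lie_ideal I -> (I <= env_sub E)%VS -> I = 0%VS).

(* The canonical enveloping pair of a Bol algebra is unique up to an
   isomorphism compatible with the inclusions, so that the choice of the pairs
   E and E' is immaterial. *)
Definition isotopic (R : realType) (B B' : bolAlgebra R) : Prop :=
  exists (E : enveloping B) (E' : enveloping B'),
    [/\ env_canonical E, env_canonical E' &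
      exists (Phi : 'Hom(env_lie E, env_lie E')) (xi : env_lie E'),
        [/\ lie_isomorphism Phi,
            (Phi @: env_base E)%VS = env_base E',
            xi \in env_base E' &
            [set` (Phi @: env_sub E)%VS] = lie_Ad xi @` [set` env_sub E']]].

(* Bases e_1, e_2, e_3 are indexed from 0: e_(i+1) is e`_i, so that the index
   triple (1, 2, 2) below stands for (e_2, e_3, e_3). *)
Definition typeII_basis (R : realType) (B : bolAlgebra R) (e : 3.-tuple B)
    : Prop :=
  basis_of fullv e /\
  forall i j k : 'I_3,
    btri e`_i e`_j e`_k =
      if [&& i == 1 :> nat, j == 2 :> nat & k == 2 :> nat] then e`_0
      else if [&& i == 2 :> nat, j == 1 :> nat & k == 2 :> nat] then - e`_0
      else 0.

Definition typeII (R : realType) (B : bolAlgebra R) : Prop :=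
  exists e : 3.-tuple B, typeII_basis e.

Definition mul23_table (R : realType) (B : bolAlgebra R) (e : 3.-tuple B)
    (v : B) : Prop :=
  forall i j : 'I_3,
    bmul e`_i e`_j =
      if (i == 1 :> nat) && (j == 2 :> nat) then v
      else if (i == 2 :> nat) && (j == 1 :> nat) then - v
      else 0.

(* Main.v *)
Require Import Defs.
From HB Require Import structures.
From mathcomp Require Import all_boot all_order all_algebra.
From mathcomp Require Import all_classical all_reals all_analysis.
Import GRing.Theory.
Import numFieldNormedType.Exports VectorInternalTheory.
Local Open Scope ring_scope.

(** Write e1, e2, e3 for a Type II basis (the entries e`_0, e`_1, e`_2), regard
    it as lying in the enveloping algebra G, and put f = [e2,e3]; then
    [f,e3] = e1, [f,e2] = 0, and both [e1,e2] and [e1,e3] commute with e1, e2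
    and e3.

    The bracket [e1,e2] vanishes by the Jacobi identity.  So does z = [e1,e3],
    because dim G = 4: the operator [-,e3] acts by e2 -> f -> e1 -> z -> 0, so
    if z were nonzero this chain would be a basis of G and the kernel of
    [-,e3] would be the line of z; as e3 lies in that kernel it would be a
    multiple of z, which commutes with e2, contradicting f != 0
    (typeII_env_lbr1).  Projecting onto B, the only nonzero product of basis
    vectors, up to skew-symmetry, is e2.e3 = -v, with v = a e1 + b e2 + c e3
    (bmul_typeII_dim4).

    Changes of basis in B that preserve the Type II form normalise v
    (typeII_change_basis):
    - if c != 0, the basis (c e1, c^-1 e2, v) gives e2.e3 = -e3;
    - if c = 0 and b != 0, the basis (b^-1 e1, v, b^-1 e3) gives e2.e3 = -e2;
    - if b = c = 0 and a != 0, the basis (a^2 e1, e2, a e3) gives e2.e3 = -e1.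
    In these cases B itself is an algebra of the list.

    If v = 0 the product of B is zero and h is the line of f.  Keep G and the
    subspace B, and replace h by the line h' of f + e1.  As [e3, f + e1] = -e1
    and [e3, e1] = 0, the operator Ad e3 maps f + e1 to f, hence h' onto h.
    The Bol algebra cut out by h' has the same triple product and the product
    x.y = -(x,y,e3), that is, e2.e3 = -e1 (triple_isotopic). *)

(** * Alternating bilinear maps in dimension three *)

HB.instance Definition _ (R : realType) (G : lieAlgebra R) (x : G) :=
  GRing.isLinear.Build R G G *:%R (lbr x) (lbr_linearr x).

HB.instance Definition _ (R : realType) (B : bolAlgebra R) (x y : B) :=
  GRing.isLinear.Build R B B *:%R (btri x y) (btri_linear3 x y).

Lemma alternatingC {R : realType} {V W : lmodType R} {f : V -> V -> W}
    (fl : forall y, linear (f^~ y)) (fr : forall x, linear (f x))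
    (fxx : forall x, f x x = 0) (x y : V) : f x y = - f y x.
Proof.
have fD : f (x + y) (x + y) = f x y + f y x.
  have := fl (x + y) 1 x y; have := fr x 1 x y; have := fr y 1 x y.
  by rewrite !scale1r => -> -> ->; rewrite !fxx add0r addr0.
by apply/eqP; rewrite -addr_eq0 -fD fxx.
Qed.

Lemma lbrC {R : realType} {G : lieAlgebra R} (x y : G) : lbr x y = - lbr y x.
Proof. exact: (alternatingC (@lbr_linearl _ G) (@lbr_linearr _ G) (@lbrxx _ G)). Qed.

Lemma lbr0l {R : realType} {G : lieAlgebra R} (x : G) : lbr 0 x = 0.
Proof. by rewrite lbrC linear0 oppr0. Qed.

Lemma lbrDl {R : realType} {G : lieAlgebra R} (x y z : G) :
  lbr (x + y) z = lbr x z + lbr y z.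
Proof. by rewrite lbrC linearD opprD -!(lbrC _ z). Qed.

Lemma lbrZl {R : realType} {G : lieAlgebra R} (a : R) (x z : G) :
  lbr (a *: x) z = a *: lbr x z.
Proof. by rewrite lbrC linearZ -scalerN -lbrC. Qed.

(** Numbered from 1, like the basis e1, e2, e3; the coordinate along e1 does not
    influence the product, the triple product or the bracket. *)
Definition coord2 {R : realType} {V : vectType R} (e : 3.-tuple V) : V -> R :=
  coord e (1 : 'I_3).
Definition coord3 {R : realType} {V : vectType R} (e : 3.-tuple V) : V -> R :=
  coord e (2%:R : 'I_3).

HB.instance Definition _ {R : realType} {V : vectType R} (e : 3.-tuple V) :=
  GRing.Linear.copy (coord2 e) (coord e (1 : 'I_3)).
HB.instance Definition _ {R : realType} {V : vectType R} (e : 3.-tuple V) :=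
  GRing.Linear.copy (coord3 e) (coord e (2%:R : 'I_3)).

Definition minor23 {R : realType} {V : vectType R} (e : 3.-tuple V) (x y : V) :=
  coord2 e x * coord3 e y - coord3 e x * coord2 e y.

Lemma basis3_expand {R : realType} {V : vectType R} {e : 3.-tuple V}
    (eB : basis_of fullv e) (x : V) :
  x = coord e (0 : 'I_3) x *: e`_0 + coord2 e x *: e`_1 + coord3 e x *: e`_2.
Proof.
rewrite {1}(coord_basis eB (memvf x)) !big_ord_recl big_ord0 addr0 addrA.
rewrite (_ : lift 0 0 = 1 :> 'I_3); last exact/val_inj.
by rewrite (_ : lift 0 (lift 0 0) = 2%:R :> 'I_3); last exact/val_inj.
Qed.

Lemma coord23_basis {R : realType} {V : vectType R} {e : 3.-tuple V}
    (eB : basis_of fullv e) :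
  [/\ (coord2 e e`_0 = 0) * (coord3 e e`_0 = 0),
      (coord2 e e`_1 = 1) * (coord3 e e`_1 = 0)
    & (coord2 e e`_2 = 0) * (coord3 e e`_2 = 1)].
Proof.
have H (i j : 'I_3) : coord e i e`_j = (i == j)%:R.
  by rewrite eq_sym; apply: coord_free; apply: basis_free eB.
by split; split; [apply: (H 1 0)|apply: (H 2%:R 0)|apply: (H 1 1)
  |apply: (H 2%:R 1)|apply: (H 1 2%:R)|apply: (H 2%:R 2%:R)].
Qed.

(** The common shape of the product, of the triple product with its third
    argument fixed, and of the bracket of G restricted to B: each kills e1, so
    only the (e2, e3) minor of the coordinates survives. *)
Lemma alternating_expand {R : realType} {V : vectType R} {W : lmodType R}
    {e : 3.-tuple V} (eB : basis_of fullv e) {f : V -> V -> W}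
    (fl : forall y, linear (f^~ y)) (fr : forall x, linear (f x))
    (fxx : forall x, f x x = 0) (f01 : f e`_0 e`_1 = 0) (f02 : f e`_0 e`_2 = 0)
    (x y : V) :
  f x y = minor23 e x y *: f e`_1 e`_2.
Proof.
have fC := alternatingC fl fr fxx.
have f0r x' : f x' 0 = 0.
  by have := fr x' (-1) 0 0; rewrite !scaler0 addr0 scaleN1r addNr.
have f0l y' : f 0 y' = 0 by rewrite fC f0r oppr0.
have f0y y' : f e`_0 y' = 0.
  rewrite (basis3_expand eB y') -!addrA fr fxx scaler0 add0r.
  by rewrite fr f01 scaler0 add0r -[_ *: _]addr0 fr f02 f0r scaler0 addr0.
have fx z z1 z2 : f (z1 *: e`_1 + z2 *: e`_2) z = z1 *: f e`_1 z + z2 *: f e`_2 z.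
  by rewrite fl -[z2 *: e`_2]addr0 fl f0l addr0.
rewrite {1}(basis3_expand eB x) -addrA fl f0y scaler0 add0r fx.
have f1y : f e`_1 y = coord3 e y *: f e`_1 e`_2.
  rewrite {1}(basis3_expand eB y) -!addrA fr fC f0y oppr0 scaler0 add0r.
  by rewrite fr fxx scaler0 add0r -[_ *: e`_2]addr0 fr f0r addr0.
have f2y : f e`_2 y = - (coord2 e y *: f e`_1 e`_2).
  rewrite {1}(basis3_expand eB y) -!addrA fr fC f0y oppr0 scaler0 add0r.
  by rewrite fr -[_ *: e`_2]addr0 fr fxx f0r scaler0 !addr0 fC scalerN.
by rewrite f1y f2y scalerN !scalerA -scalerBl.
Qed.

Lemma btri_typeII {R : realType} {B : bolAlgebra R} {e : 3.-tuple B}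
    (He : typeII_basis e) (x y z : B) :
  btri x y z = (minor23 e x y * coord3 e z) *: e`_0.
Proof.
case: He => eB He.
have f0k k z' : btri e`_0 e`_(k : 'I_3) z' = 0.
  rewrite (basis3_expand eB z') !linearD !linearZ /=.
  by rewrite (He 0 k 0) (He 0 k 1) (He 0 k 2%:R) /= !scaler0 !addr0.
have -> : btri x y z = minor23 e x y *: btri e`_1 e`_2 z.
  apply: (alternating_expand eB (f := fun x y => btri x y z)).
  - by move=> y'; apply: btri_linear1.
  - by move=> x'; apply: btri_linear2.
  - by move=> x'; apply: btrixx.
  - exact: (f0k 1).
  - exact: (f0k 2%:R).
rewrite {1}(basis3_expand eB z) !linearD !linearZ /=.
rewrite (He 1 2%:R 0) (He 1 2%:R 1) (He 1 2%:R 2%:R) /=.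
by rewrite !scaler0 !add0r scalerA mulrC.
Qed.

(** * Changing a Type II basis *)

(** With u in span(e1,e2), the minor of (u, v) is coord2 u * coord3 v, which is
    the factor of the new product; the triple product (u,v,v) picks up one more
    factor coord3 v, and its value has to be the first vector of the basis. *)
Lemma typeII_change_basis {R : realType} {B : bolAlgebra R} {e : 3.-tuple B}
    (He : typeII_basis e) {m : B}
    (mulE : forall x y, bmul x y = minor23 e x y *: m) {u v : B}
    (u2 : coord2 e u != 0) (u3 : coord3 e u = 0)
    (v3 : coord3 e v != 0) :
  let mu := coord2 e u * coord3 e v in
  let e' := [tuple (mu * coord3 e v) *: e`_0; u; v] in
  typeII_basis e' /\ mul23_table e' (mu *: m).
Proof.
move=> mu e'; have eB := He.1.
have [c0 c1 c2] := coord23_basis eB.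
have rho0 : mu * coord3 e v != 0 by rewrite !mulf_neq0.
have c0' k : (coord2 e (k *: e`_0) = 0) * (coord3 e (k *: e`_0) = 0).
  by rewrite !linearZ /= !c0 mulr0.
have e0_neq0 : e`_0 != 0 by rewrite (basis_not0 eB) ?mem_nth ?size_tuple.
split; [split|].
- rewrite basisEfree; apply/and3P; split; [|exact: subvf|by rewrite (size_basis eB)].
  apply/freeP => k; rewrite !big_ord_recl big_ord0 /= addr0 => k0.
  set k1 := k (lift _ _) in k0; set k2 := k (lift _ _) in k0.
  have k20 : k2 = 0.
    have := congr1 (coord3 e) k0.
    rewrite !linearD !linearZ /= u3 c0 linear0 !mulr0 !add0r => /eqP.
    by rewrite mulf_eq0 (negPf v3) orbF => /eqP.
  have k10 : k1 = 0.
    have := congr1 (coord2 e) k0.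
    rewrite k20 !linearD !linearZ /= c0 linear0 !mulr0 !add0r mul0r addr0.
    by move/eqP; rewrite mulf_eq0 (negPf u2) orbF => /eqP.
  have k00 : k 0 = 0.
    move: k0; rewrite k10 k20 !scale0r !addr0 scalerA => /eqP.
    by rewrite scaler_eq0 (negPf e0_neq0) orbF mulf_eq0 (negPf rho0) orbF => /eqP.
  case=> -[|[|[|//]]] lt_i.
  + by rewrite -[RHS]k00; congr (k _); apply/val_inj.
  + by rewrite -[RHS]k10; congr (k _); apply/val_inj.
  + by rewrite -[RHS]k20; congr (k _); apply/val_inj.
- case=> -[|[|[|//]]] lt_i [] [|[|[|//]]] lt_j [] [|[|[|//]]] lt_k /=;
    rewrite (btri_typeII He) /minor23 ?c0' ?u3
      ?(mulr0, mul0r, subr0, sub0r, oppr0, scale0r) //.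
  all: rewrite ?[coord3 e v * _]mulrC ?mulrN ?mulNr ?scaleNr ?subrr ?mul0r ?scale0r //.
- case=> -[|[|[|//]]] lt_i [] [|[|[|//]]] lt_j /=;
    rewrite mulE /minor23 ?c0' ?u3
      ?(mulr0, mul0r, subr0, sub0r, oppr0, scale0r) //.
  all: rewrite ?[coord3 e v * _]mulrC ?scaleNr ?subrr ?scale0r //.
Qed.

(** * The adjoint action and the identity isotopy *)

(** The exponential series stops after its linear term. *)
Lemma lie_Ad_order2 {R : realType} {G : lieAlgebra R} (x y : G) :
  lbr x (lbr x y) = 0 -> lie_Ad x y = y + lbr x y.
Proof.
move=> xxy; rewrite /lie_Ad.
rewrite (@lim_near_cst _ _ _ _ _ (v2r (y + lbr x y))) ?v2rK //.
exists 2%N => //= n /= n2; rewrite /series /= -(subnK n2) addnC.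
rewrite big_nat_recl // big_nat_recl //= big1 ?addr0.
  by rewrite fact0 factS fact0 !invr1 !scale1r linearD.
move=> k _; rewrite (_ : lbr x _ = 0) ?linear0 ?scaler0 //.
by elim: k => [|k IH] /=; rewrite ?xxy // IH linear0.
Qed.

Lemma lie_isomorphism_id {R : realType} {G : lieAlgebra R} :
  lie_isomorphism (\1%VF : 'Hom(G, G)).
Proof.
split; [|by rewrite lim1g|by move=> x y; rewrite !id_lfunE].
by apply/eqP; rewrite -subv0; apply/subvP => x; rewrite memv_ker id_lfunE memv0.
Qed.

Lemma isotopic_refl {R : realType} {B : bolAlgebra R} (E : enveloping B) :
  env_canonical E -> isotopic B B.
Proof.
move=> canE; exists E, E; split => //; exists \1%VF, 0; split.
- exact: lie_isomorphism_id.
- by rewrite lim1g.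
- exact: mem0v.
- rewrite lim1g; have Ad0 y : lie_Ad 0 y = y :> env_lie E.
    by rewrite lie_Ad_order2 ?lbr0l ?addr0 ?linear0.
  apply/seteqP; split => y /=; first by exists y.
  by case=> z hz <-; rewrite Ad0.
Qed.

(** * The four-dimensional enveloping algebra *)

(** If z = [e1,e3] were nonzero, the chain e2 -> f -> e1 -> z of the nilpotent
    operator [-,e3] would fill G, and e3, which that operator kills, would be a
    multiple of z; but z commutes with e2 whereas e3 does not. *)
Lemma typeII_env_lbr1 {R : realType} {B : bolAlgebra R} (E : enveloping B)
    {e : 3.-tuple B} (He : typeII_basis e) (dimE : \dim {:env_lie E} = 4%N) :
  let eps i := env_inj E e`_i in
  lbr (eps 0%N) (eps 1%N) = 0 /\ lbr (eps 0%N) (eps 2%N) = 0.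
Proof.
move=> eps; have eB := He.1.
have [c0 c1 c2] := coord23_basis eB.
have injE x : env_inj E x = 0 -> x = 0.
  by move/eqP; rewrite -memv_ker env_inj_ker memv0 => /eqP.
set f := lbr (eps 1%N) (eps 2%N).
have triE (i j k : nat) : lbr (lbr (eps i) (eps j)) (eps k) =
    (minor23 e e`_i e`_j * coord3 e e`_k) *: eps 0%N.
  by rewrite -env_tri (btri_typeII He) linearZ.
have f3 : lbr f (eps 2%N) = eps 0%N.
  by rewrite triE /minor23 c1 !c2 mulr0 subr0 !mulr1 scale1r.
have f2 : lbr f (eps 1%N) = 0 by rewrite triE c1 mulr0 scale0r.
have eps0_neq0 : eps 0%N != 0.
  have e0_neq0 : e`_0 != 0 by rewrite (basis_not0 eB) ?mem_nth ?size_tuple.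
  by apply: contra e0_neq0 => /eqP/injE ->.
(* Jacobi for f, e3, e2: the terms [f,f] and [e3,[e2,f]] vanish. *)
have eps01 : lbr (eps 0%N) (eps 1%N) = 0.
  have := lbr_jacobi f (eps 2%N) (eps 1%N).
  rewrite [lbr (eps 2%N) (eps 1%N)]lbrC -/f f3 linearN /= lbrxx oppr0 add0r.
  rewrite [lbr (eps 1%N) f]lbrC f2 oppr0 linear0 add0r => eps10.
  by rewrite lbrC eps10 oppr0.
split=> //; set z := lbr _ _; apply/eqP/negPn/negP => z_neq0.
have z2 : lbr z (eps 2%N) = 0 by rewrite triE /minor23 !c0 !mul0r subr0 mul0r scale0r.
have z1 : lbr z (eps 1%N) = 0 by rewrite triE /minor23 !c0 !mul0r subr0 mul0r scale0r.
(* Applying [-,e3] repeatedly shifts the coefficients down to z one by one. *)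
have ker2 p q r s : lbr (p *: z + q *: eps 0%N + r *: f + s *: eps 1%N) (eps 2%N) = 0 ->
    [/\ q = 0, r = 0 & s = 0].
  pose simpD := (lbrDl, lbrZl, z2, f3, lbr0l, scaler0, addr0, add0r).
  have sc0 t : t *: z = 0 -> t = 0.
    by move/eqP; rewrite scaler_eq0 (negPf z_neq0) orbF => /eqP.
  rewrite !simpD -/f -/z => D1.
  have := congr1 (fun x => lbr x (eps 2%N)) D1; rewrite !simpD -/z => D2.
  have := congr1 (fun x => lbr x (eps 2%N)) D2; rewrite !simpD -/z => D3.
  have s0 := sc0 _ D3; rewrite s0 !scale0r !addr0 in D1 D2.
  have r0 := sc0 _ D2; rewrite r0 !scale0r !addr0 in D1.
  by rewrite (sc0 _ D1).
have chainB : basis_of fullv [tuple z; eps 0%N; f; eps 1%N].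
  rewrite basisEfree subvf dimE /= andbT; apply/freeP => k.
  rewrite !big_ord_recl big_ord0 /= addr0 !addrA => k0.
  have k0D := etrans (congr1 (fun x => lbr x (eps 2%N)) k0) (lbr0l _).
  have [k1 k2 k3] := ker2 _ _ _ _ k0D.
  move: k0; rewrite k1 k2 k3 !scale0r !addr0 => /eqP.
  rewrite scaler_eq0 (negPf z_neq0) orbF => /eqP k00.
  case=> -[|[|[|[|//]]]] lt_i.
  + by rewrite -[RHS]k00; congr (k _); apply/val_inj.
  + by rewrite -[RHS]k1; congr (k _); apply/val_inj.
  + by rewrite -[RHS]k2; congr (k _); apply/val_inj.
  + by rewrite -[RHS]k3; congr (k _); apply/val_inj.
have := coord_basis chainB (memvf (eps 2%N)).
rewrite !big_ord_recl big_ord0 /= addr0 !addrA => eps2E.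
have eps2D := congr1 (fun x => lbr x (eps 2%N)) (esym eps2E).
have [q0 r0 s0] := ker2 _ _ _ _ (etrans eps2D (lbrxx _)).
move: eps2E; rewrite q0 r0 s0 !scale0r !addr0 => eps2E.
move/eqP: eps0_neq0; apply.
by rewrite -f3 {1}/f {1}eps2E linearZ /= [lbr (eps 1%N) z]lbrC z1 oppr0 scaler0 lbr0l.
Qed.

Lemma bmul_typeII_dim4 {R : realType} {B : bolAlgebra R} (E : enveloping B)
    {e : 3.-tuple B} (He : typeII_basis e) (dimE : \dim {:env_lie E} = 4%N)
    (x y : B) :
  bmul x y = minor23 e x y *: bmul e`_1 e`_2.
Proof.
have mul0 u v : lbr (env_inj E u) (env_inj E v) = 0 -> bmul u v = 0.
  move=> uv0; apply/eqP; rewrite -memv0 -(env_inj_ker E) memv_ker.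
  by rewrite env_mul uv0 linear0.
have [eps01 eps02] := typeII_env_lbr1 E He dimE.
apply: (alternating_expand He.1); [exact: bmul_linearl|exact: bmul_linearr
  |exact: bmulxx|exact: mul0|exact: mul0].
Qed.

(** * The isotope of the algebra with zero product *)

Section TripleIsotope.
Context {R : realType} {B : bolAlgebra R} {e : 3.-tuple B}.
Context (He : typeII_basis e).

(** The product cut out on B by the line of f + e1; phrased through the triple
    product it inherits bilinearity and skew-symmetry. *)
Definition triple_mul (x y : B) : B := - btri x y e`_2.

Lemma triple_mulE x y : triple_mul x y = - minor23 e x y *: e`_0.
Proof.
have [_ _ c2] := coord23_basis He.1.
by rewrite /triple_mul (btri_typeII He) c2 mulr1 scaleNr.
Qed.

Lemma triple_mul_linearl y : linear (fun x => triple_mul x y).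
Proof. by move=> a x x'; rewrite /triple_mul btri_linear1 opprD scalerN. Qed.

Lemma triple_mul_linearr x : linear (fun y => triple_mul x y).
Proof. by move=> a y y'; rewrite /triple_mul btri_linear2 opprD scalerN. Qed.

Lemma triple_mulxx x : triple_mul x x = 0.
Proof. by rewrite /triple_mul btrixx oppr0. Qed.

(** All values of both operations are multiples of e1, and e1 annihilates both
    operations, so each of the five terms is zero. *)
Lemma triple_mul_bol x y z u :
  triple_mul (btri x y z) u - triple_mul (btri x y u) z
    + btri z u (triple_mul x y) - btri x y (triple_mul z u)
    + triple_mul (triple_mul x y) (triple_mul z u) = 0.
Proof.
have [c0 _ _] := coord23_basis He.1.
have coord0 a : (coord2 e (a *: e`_0) = 0) * (coord3 e (a *: e`_0) = 0).
  by rewrite !linearZ /= !c0 mulr0.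
rewrite !triple_mulE !(btri_typeII He) /minor23 !coord0.
by rewrite !(mul0r, mulr0, subr0, oppr0, scale0r, addr0).
Qed.

Definition triple_isotope : bolAlgebra R :=
  BolAlgebra triple_mul_linearl triple_mul_linearr
    (@btri_linear1 R B) (@btri_linear2 R B) (@btri_linear3 R B)
    triple_mulxx (@btrixx R B) (@btri_cyclic R B) (@btri_derivation R B)
    triple_mul_bol.

Lemma triple_isotope_table :
  mul23_table (e : 3.-tuple triple_isotope) (- e`_0).
Proof.
have [c0 c1 c2] := coord23_basis He.1.
case=> -[|[|[|//]]] lt_i [] [|[|[|//]]] lt_j;
  rewrite -[LHS]/(triple_mul _ _) triple_mulE /minor23 /= ?c0 ?c1 ?c2.
all: by rewrite !(mul0r, mulr0, mulr1, subr0, sub0r, oppr0, opprK, scale0r, scaleN1r, scale1r).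
Qed.

Context {E : enveloping B}.
Context (canE : env_canonical E) (dimE : \dim {:env_lie E} = 4%N).
Context (mul0 : forall x y : B, bmul x y = 0).

Let f := lbr (env_inj E e`_1) (env_inj E e`_2).
Let eps1 := env_inj E e`_0.

Lemma lbr_env x y : lbr (env_inj E x) (env_inj E y) = minor23 e x y *: f.
Proof.
have [eps01 eps02] := typeII_env_lbr1 E He dimE.
apply: (alternating_expand He.1 (f := fun x y => lbr (env_inj E x) (env_inj E y))) => //.
- by move=> z a u v; rewrite linearP lbr_linearl.
- by move=> z a u v; rewrite !linearP.
- by move=> z; rewrite lbrxx.
Qed.

Lemma lbr_fE x : lbr f (env_inj E x) = coord3 e x *: eps1.
Proof.
have [c0 c1 c2] := coord23_basis He.1.
rewrite -env_tri (btri_typeII He) linearZ /= /minor23 !c1 !c2.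
by rewrite mulr0 subr0 mulr1 mul1r.
Qed.

Lemma eps1_neq0 : eps1 != 0.
Proof.
have e0_neq0 : e`_0 != 0 by rewrite (basis_not0 He.1) ?mem_nth ?size_tuple.
by apply: contra e0_neq0; rewrite -memv_ker env_inj_ker memv0.
Qed.

Lemma f_neq0 : f != 0.
Proof.
have [_ _ c2] := coord23_basis He.1.
apply: contraNneq eps1_neq0 => f0.
by rewrite -[eps1]scale1r -c2.2 -lbr_fE f0 lbr0l.
Qed.

Lemma env_inj_base x : env_inj E x \in env_base E.
Proof. exact: memv_img (memvf x). Qed.

(** The projection of f = [e2,e3] onto B is the product of e2 and e3, zero here. *)
Lemma f_sub : f \in env_sub E.
Proof.
have := daddv_pi_add (env_direct E) (w := f).
rewrite env_full memvf -env_mul mul0 linear0 add0r => /(_ isT) <-.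
exact: memv_pi.
Qed.

Lemma f_notin_base : f \notin env_base E.
Proof.
apply: contra f_neq0 => f_base.
by rewrite -memv0 -(env_direct E) memv_cap f_base f_sub.
Qed.

Lemma dim_env_base : \dim (env_base E) = 3%N.
Proof.
rewrite /env_base limg_dim_eq; last by rewrite env_inj_ker capv0.
by rewrite (size_basis He.1).
Qed.

Lemma env_sub_line : env_sub E = <[f]>%VS.
Proof.
apply/esym/eqP; rewrite eqEdim -memvE f_sub dim_vline f_neq0 /=.
have := dimv_disjoint_sum (env_direct E).
by rewrite env_full dimE dim_env_base => -[->].
Qed.

Definition isotope_sub : {vspace env_lie E} := <[f + eps1]>%VS.

Lemma isotope_gen_notin_base : f + eps1 \notin env_base E.
Proof. by rewrite rpredDr ?env_inj_base // f_notin_base. Qed.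

Lemma isotope_sub_lie : lie_subalgebra isotope_sub.
Proof.
move=> _ _ /vlineP[a ->] /vlineP[b ->].
by rewrite lbrZl linearZ /= lbrxx !scaler0 mem0v.
Qed.

Lemma isotope_direct : (env_base E :&: isotope_sub)%VS = 0%VS.
Proof.
apply/eqP; rewrite -subv0; apply/subvP => x /memv_capP[base_x /vlineP[a xE]].
move: base_x; rewrite {}xE; have [->|a_neq0] := eqVneq a 0; first by rewrite scale0r !mem0v.
by rewrite rpredZeq (negPf a_neq0) (negPf isotope_gen_notin_base).
Qed.

Lemma isotope_full : (env_base E + isotope_sub)%VS = fullv.
Proof.
apply/eqP; rewrite eqEdim subvf dimv_disjoint_sum ?isotope_direct //.
rewrite dimE dim_env_base dim_vline; case: eqP => // g0.
by have := isotope_gen_notin_base; rewrite g0 mem0v.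
Qed.

(** As f + e1 projects to 0, f projects to - e1. *)
Lemma isotope_mul (x y : triple_isotope) :
  env_inj E (bmul x y) =
    daddv_pi (env_base E) isotope_sub (lbr (env_inj E x) (env_inj E y)).
Proof.
have proj0 : daddv_pi (env_base E) isotope_sub (f + eps1) = 0.
  have := daddv_pi_add isotope_direct (w := f + eps1).
  rewrite isotope_full memvf => /(_ isT).
  rewrite [daddv_pi isotope_sub _ _]daddv_pi_id ?memv_line 1?capvC ?isotope_direct //.
  by move/(canRL (addrK _)); rewrite subrr.
have projf : daddv_pi (env_base E) isotope_sub f = - eps1.
  move: proj0; rewrite linearD /= [daddv_pi _ _ eps1]daddv_pi_id ?isotope_direct ?env_inj_base //.
  by move/(canRL (addrK _)); rewrite sub0r.
rewrite -[bmul x y]/(triple_mul x y) triple_mulE lbr_env linearZ.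
by rewrite [in RHS]linearZ /= projf scalerN scaleNr.
Qed.

Definition isotope_env : enveloping triple_isotope :=
  @Enveloping R triple_isotope (env_lie E) (env_inj E) isotope_sub
    (env_inj_ker E) isotope_sub_lie isotope_full isotope_direct
    (@env_triple R B E) isotope_mul (@env_tri R B E).

(** An ideal inside the line of f + e1 is stable under [e3,-], which sends
    a (f + e1) to - a e1; this lies in B, which meets the line only in 0. *)
Lemma isotope_env_canonical : env_canonical isotope_env.
Proof.
split; first exact: canE.1.
move=> I idealI /subvP I_sub; apply/eqP; rewrite -subv0; apply/subvP => x Ix.
have /vlineP[a xE] := I_sub _ Ix; have [_ _ c2] := coord23_basis He.1.
have : lbr (env_inj E e`_2) x \in isotope_sub by apply/I_sub/idealI.
rewrite lbrC xE lbrZl lbrDl lbr_fE c2.2 scale1r.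
have -> : lbr eps1 (env_inj E e`_2) = 0 by have [] := typeII_env_lbr1 E He dimE.
rewrite addr0 memvN => a_sub.
have : a *: eps1 \in (env_base E :&: isotope_sub)%VS.
  by rewrite memv_cap a_sub rpredZ ?env_inj_base.
rewrite isotope_direct !memv0 !scaler_eq0 (negPf eps1_neq0) orbF => ->.
by [].
Qed.

Lemma triple_isotopic : isotopic B triple_isotope.
Proof.
exists E, isotope_env; split=> //; first exact: isotope_env_canonical.
exists \1%VF, (env_inj E e`_2); split.
- exact: lie_isomorphism_id.
- by rewrite lim1g.
- exact: env_inj_base.
rewrite lim1g env_sub_line.
have [_ _ c2] := coord23_basis He.1; have [_ eps02] := typeII_env_lbr1 E He dimE.
have ad_e3 a : lbr (env_inj E e`_2) (a *: (f + eps1)) = - (a *: eps1).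
  by rewrite lbrC lbrZl lbrDl lbr_fE c2.2 scale1r eps02 addr0.
have Ad_e3 a : lie_Ad (env_inj E e`_2) (a *: (f + eps1)) = a *: f.
  rewrite lie_Ad_order2 ad_e3; first by rewrite -scalerBr addrK.
  by rewrite linearN linearZ /= lbrC eps02 oppr0 scaler0 oppr0.
apply/seteqP; split=> [_ /vlineP[a ->]|_ [_ /vlineP[a ->] <-]] /=.
  by exists (a *: (f + eps1)); rewrite /= ?Ad_e3 // rpredZ ?memv_line.
by rewrite Ad_e3 rpredZ ?memv_line.
Qed.

End TripleIsotope.

(** * The classification *)

Theorem mainTheorem4 (R : realType) (B : bolAlgebra R) (E : enveloping B)
    (dimB : \dim {:B} = 3%N) (tyB : typeII B)
    (canE : env_canonical E) (dimE : \dim {:env_lie E} = 4%N) :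
  exists (B' : bolAlgebra R) (e : 3.-tuple B'),
    [/\ typeII_basis e,
        [\/ mul23_table e (- e`_2),
            mul23_table e (- e`_1)
          | mul23_table e (- e`_0)]
      & isotopic B B'].
Proof.
case: tyB => e He; have eB := He.1.
have [c0 c1 c2] := coord23_basis eB.
pose v : B := - bmul e`_1 e`_2.
have mulE x y : bmul x y = minor23 e x y *: - v.
  by rewrite opprK (bmul_typeII_dim4 E He dimE).
have vE := basis3_expand eB v.
set a := coord _ _ _ in vE; set b := coord2 _ _ in vE; set c := coord3 _ _ in vE.
have [c_eq0|c_neq0] := eqVneq c 0; last first.
  have u2 : coord2 e (c^-1 *: e`_1) = c^-1 by rewrite linearZ /= c1 mulr1.
  have u3 : coord3 e (c^-1 *: e`_1) = 0 by rewrite linearZ /= c1 mulr0.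
  have [] := typeII_change_basis He mulE _ u3 c_neq0; first by rewrite u2 invr_neq0.
  rewrite -/c u2 mulVf // scale1r => He' mulT.
  exists B, [tuple (1 * c) *: e`_0; c^-1 *: e`_1; v].
  by split; [|constructor 1|exact: (isotopic_refl E canE)].
have [b_eq0|b_neq0] := eqVneq b 0; last first.
  have v3 : coord3 e (b^-1 *: e`_2) = b^-1 by rewrite linearZ /= c2 mulr1.
  have [] := typeII_change_basis (v := b^-1 *: e`_2) He mulE b_neq0 c_eq0.
    by rewrite v3 invr_neq0.
  rewrite -/b v3 mulfV // scale1r => He' mulT.
  exists B, [tuple (1 * b^-1) *: e`_0; v; b^-1 *: e`_2].
  by split; [|constructor 2|exact: (isotopic_refl E canE)].
rewrite c_eq0 b_eq0 !scale0r !addr0 in vE.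
have [a_eq0|a_neq0] := eqVneq a 0; last first.
  have v3 : coord3 e (a *: e`_2) = a by rewrite linearZ /= c2 mulr1.
  have [|||] := typeII_change_basis (u := e`_1) (v := a *: e`_2) He mulE.
  - by rewrite c1 oner_neq0.
  - by rewrite c1.
  - by rewrite v3.
  rewrite v3 c1 mul1r scalerN vE scalerA => He' mulT.
  exists B, [tuple (a * a) *: e`_0; e`_1; a *: e`_2].
  by split; [|constructor 3|exact: (isotopic_refl E canE)].
have mul0 (x y : B) : bmul x y = 0 by rewrite mulE vE a_eq0 scale0r oppr0 scaler0.
exists (triple_isotope He), e; split; first exact: He.
  by constructor 3; exact: triple_isotope_table.
exact: (triple_isotopic He canE dimE mul0).
Qed.
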